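(* Consider the linear control system $\dot y=Ay+Bu$, $y(0)=y_0$, with the quadratic stage cost $$\tilde J_1=\tfrac12\int_t^{t+T}\|Qy(\tau)\|_H^2\,d\tau+\tfrac12\langle P_Ty(t+T),y(t+T)\rangle_H,$$ reference control $u_1=0$, and the SAC action $u_{\mathrm{opt}}(t)$ and closed-loop operator $G$ defined in the context. The following statements hold. (1) The SAC action satisfies $$u_{\mathrm{opt}}(t)=\alpha_d(R^\star)^{-1}B^\star\overline F\,y(t)+o(\|y\|_H)\qquad\text{for }\|y\|_H\to0.$$ (2) The nonlinear operator $G\colon H\to H$ is Fréchet differentiable. (3) The linearization at the equilibrium $y=0$ of the closed-loop system $\dot y(t)=Ay(t)+G(y(t))$, $y(0)=y_0$ (continuous application of the controls computed by SAC), is the system under linear feedback $$\dot y(t)=\big(A+\alpha_dB(R^\star)^{-1}B^\star\overline F\big)y(t),\quad t\ge0,\qquad y(0)=y_0.$$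
   Context: $H$ and $U$ are real separable Hilbert spaces, identified with their duals; $^\star$ denotes the Hilbert space adjoint. $A$ is densely defined on $D(A)\subset H$ and generates a strongly continuous semigroup $e^{tA}$ on $H$; $B\colon U\to H$ and $Q\colon H\to H$ are bounded linear operators; $P_T$ is a positive self-adjoint operator on $H$; $R\colon U\to U$ is bounded, self-adjoint and coercive: $\langle Ru,u\rangle_U\ge\gamma_R\|u\|_U^2$ for some $\gamma_R>0$ and all $u\in U$; $T>0$; $\alpha_d<0$; $y_0\in H$. $F$ is the mild solution of the differential Lyapunov equation $\dot F(\tau)=-A^\star F(\tau)-F(\tau)A-Q^\star Q$, $\tau\in(0,T)$ a.e., $F(T)=P_T$, with each $F(\tau)$ a bounded, self-adjoint, positive linear operator on $H$, and $\overline F=F(0)$, i.e. $$\overline Fy=e^{TA^\star}P_Te^{TA}y+\int_0^Te^{sA^\star}Q^\star Qe^{sA}y\,ds.$$ When the stage problem on $[t,t+T]$ starts from the state $y(t)$ with reference control $u_1=0$, the adjoint state at the initial time of the stage is $p(t)=\overline Fy(t)$. Put $P(t)\colon U\to\mathbb R$, $P(t)w=\langle p(t),Bw\rangle_H=\langle\overline Fy(t),Bw\rangle_H$, with Hilbert adjoint $P^\star(t)\colon\mathbb R\to U$; so $P^\star(t)\alpha_d=\alpha_dB^\star\overline Fy(t)$, and $P^\star(t)P(t)u=\langle B^\star\overline Fy(t),u\rangle_U\,B^\star\overline Fy(t)$ depends on $y(t)$. The SAC (sequential action control) action is the minimizer over $u\in U$ of $\frac12[\langle p(t),Bu\rangle_H-\alpha_d]^2+\frac12\langle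 u,Ru\rangle_U$, that is, $u_{\mathrm{opt}}(t)=(P^\star(t)P(t)+R^\star)^{-1}P^\star(t)\alpha_d$. Applying this control continuously gives the closed-loop system $\dot y(t)=Ay(t)+G(y(t))$, $y(0)=y_0$, where $G\colon H\to H$, $$G(y)=B\big[(P^\star P+R^\star)(y)\big]^{-1}B^\star\overline Fy\,\alpha_d,$$ and $(P^\star P+R^\star)(y)$ denotes the operator $u\mapsto\langle B^\star\overline Fy,u\rangle_U\,B^\star\overline Fy+R^\star u$ on $U$. *)

(* Defs.v *)
From Stdlib Require Import Reals ClassicalEpsilon.
From Coquelicot Require Import Coquelicot.

Set Implicit Arguments.
Unset Strict Implicit.
Unset Printing Implicit Defensive.

Open Scope R_scope.

(* Since [norm] separates points, [inner_norm] makes the form definite. *)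
Record HilbertSpace := {
  hs_space :> CompleteNormedModule R_AbsRing;
  inner : hs_space -> hs_space -> R;
  inner_sym : forall x y, inner x y = inner y x;
  inner_plus_l : forall x y z, inner (plus x y) z = inner x z + inner y z;
  inner_scal_l : forall (a : R) x y, inner (scal a x) y = a * inner x y;
  inner_norm : forall x, inner x x = norm x ^ 2
}.

Lemma R_inner_norm (x : R_CompleteNormedModule) : x * x = norm x ^ 2.
Proof.
change (norm x) with (Rabs x).
rewrite pow2_abs. ring.
Qed.

Definition R_Hilbert : HilbertSpace := {|
  hs_space := R_CompleteNormedModule;
  inner := Rmult;
  inner_sym := Rmult_comm;
  inner_plus_l := Rmult_plus_distr_r;
  inner_scal_l := Rmult_assoc;
  inner_norm := R_inner_norm
|}.

Definition dense (V : NormedModule R_AbsRing) (D : V -> Prop) : Prop :=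
  forall (x : V) (eps : posreal), exists z, D z /\ norm (minus z x) < eps.

Definition separable (V : NormedModule R_AbsRing) : Prop :=
  exists u : nat -> V, dense (fun z => exists n, z = u n).

(* Bounded linear operators are functions satisfying Coquelicot's [is_linear],
   which includes the bound on the norm. *)

(* Unique when it exists; it exists for every bounded operator (Riesz). *)
Definition adjoint (V W : HilbertSpace) (L : V -> W) : W -> V :=
  epsilon (inhabits (fun _ => zero))
    (fun S : W -> V => forall v w, inner (L v) w = inner v (S w)).

(* Unique when it exists. *)
Definition op_inverse (V W : HilbertSpace) (L : V -> W) : W -> V :=
  epsilon (inhabits (fun _ => zero))
    (fun S : W -> V =>
       is_linear S /\ (forall v, S (L v) = v) /\ (forall w, L (S w) = w)).

Definition self_adjoint (V : HilbertSpace) (L : V -> V) : Prop :=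
  forall x y, inner (L x) y = inner x (L y).

Definition positive_op (V : HilbertSpace) (L : V -> V) : Prop :=
  forall x, 0 <= inner (L x) x.

Definition coercive (V : HilbertSpace) (L : V -> V) : Prop :=
  exists gamma : R, 0 < gamma /\ forall v, gamma * norm v ^ 2 <= inner (L v) v.

(* The values of [op_fun] outside [op_dom] are irrelevant. *)
Record unbounded_operator (V : HilbertSpace) := {
  op_dom : V -> Prop;
  op_fun : V -> V
}.

Definition op_eq (V : HilbertSpace) (A1 A2 : unbounded_operator V) : Prop :=
  (forall x, op_dom A1 x <-> op_dom A2 x) /\
  (forall x, op_dom A1 x -> op_fun A1 x = op_fun A2 x).

Definition op_plus (V : HilbertSpace) (A : unbounded_operator V) (K : V -> V) :
    unbounded_operator V :=
  {| op_dom := op_dom A; op_fun := fun x => plus (op_fun A x) (K x) |}.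

(* Only the values of [S] at times [t >= 0] matter. *)
Record C0_semigroup (V : HilbertSpace) (S : R -> V -> V) : Prop := {
  sg_bounded : forall t, 0 <= t -> is_linear (S t);
  sg_0 : forall x, S 0 x = x;
  sg_plus : forall s t x, 0 <= s -> 0 <= t -> S (s + t) x = S s (S t x);
  sg_cont : forall x, filterlim (fun t => S t x) (at_right 0) (locally x)
}.

(* [A] is the infinitesimal generator of [S], stated on graphs. *)
Definition generates (V : HilbertSpace) (A : unbounded_operator V)
    (S : R -> V -> V) : Prop :=
  C0_semigroup S /\
  forall x z, (op_dom A x /\ op_fun A x = z) <->
    filterlim (fun h => scal (/ h) (minus (S h x) x)) (at_right 0) (locally z).

(* Mild solution on [0,T] of F' = -A* F - F A - Q* Q, F(T) = PT, where A
   generates [S]; the semigroup generated by A* is the adjoint of [S].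
   The integrand is continuous in [s], so the H-valued Riemann integral
   exists. *)
Record mild_lyapunov_solution (H : HilbertSpace) (S : R -> H -> H)
    (Q PT : H -> H) (T : R) (F : R -> H -> H) : Prop := {
  lyap_bounded : forall tau, 0 <= tau <= T -> is_linear (F tau);
  lyap_self_adjoint : forall tau, 0 <= tau <= T -> self_adjoint (F tau);
  lyap_positive : forall tau, 0 <= tau <= T -> positive_op (F tau);
  lyap_mild : forall tau y, 0 <= tau <= T ->
    F tau y =
    plus (adjoint (S (T - tau)) (PT (S (T - tau) y)))
         (RInt (fun s => adjoint (S (s - tau)) (adjoint Q (Q (S (s - tau) y))))
               tau T)
}.

Section SAC.

Variables (H U : HilbertSpace) (B : U -> H) (Rop : U -> U) (Fbar : H -> H)
  (alpha_d : R).

(* P, as a functional on U, when the current state is [y]; the adjoint state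
   is [Fbar y]. *)
Definition sac_P (y : H) : U -> R_Hilbert :=
  fun w => inner (Fbar y) (B w).

Definition sac_objective (y : H) (u : U) : R :=
  1 / 2 * (inner (Fbar y) (B u) - alpha_d) ^ 2 + 1 / 2 * inner u (Rop u).

Definition sac_minimizer (y : H) (u : U) : Prop :=
  forall v, sac_objective y u <= sac_objective y v.

(* (P* P + R* )^-1 P* alpha_d *)
Definition sac_action (y : H) : U :=
  op_inverse
    (fun u : U => plus (adjoint (sac_P y) (sac_P y u)) (adjoint Rop u) : U)
    (adjoint (sac_P y) alpha_d).

Definition sac_gram (y : H) (u : U) : U :=
  plus (scal (inner (adjoint B (Fbar y)) u) (adjoint B (Fbar y)))
       (adjoint Rop u).

Definition sac_G (y : H) : H :=
  B (op_inverse (sac_gram y) (scal alpha_d (adjoint B (Fbar y)))).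

End SAC.

(* y' = A y, y(0) = y0 *)
Record linear_system (H : HilbertSpace) := {
  lin_op : unbounded_operator H;
  lin_init : H
}.

(* y' = A y + G(y), y(0) = y0 *)
Record semilinear_system (H : HilbertSpace) := {
  sl_op : unbounded_operator H;
  sl_nonlin : H -> H;
  sl_init : H
}.

Definition equilibrium (H : HilbertSpace) (sys : semilinear_system H) (ye : H) :
    Prop :=
  op_dom (sl_op sys) ye /\
  plus (op_fun (sl_op sys) ye) (sl_nonlin sys ye) = zero.

(* The linear system for z = y - ye with operator A + DG(ye), where DG(ye) is
   the Frechet derivative. *)
Definition is_linearization_at (H : HilbertSpace) (sys : semilinear_system H)
    (ye : H) (lin : linear_system H) : Prop :=
  equilibrium sys ye /\
  exists DG : H -> H,
    filterdiff (sl_nonlin sys) (locally ye) DG /\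
    op_eq (lin_op lin) (op_plus (sl_op sys) DG) /\
    lin_init lin = minus (sl_init sys) ye.

(* Main.v *)
(* For b = B* Fbar y the SAC objective is a quadratic function of u with Hessian
   the rank-one perturbation u |-> <b,u> b + R u of R, which is again self-adjoint
   and coercive, so its minimizer solves <b,u> b + R u = alpha_d b.  By the
   Sherman-Morrison formula this solution is
   alpha_d / (1 + <b, R^-1 b>) R^-1 b, a scalar factor that is a smooth function
   of a quadratic form in y, times a bounded linear map of y.  Hence it is
   differentiable, with derivative alpha_d R^-1 B* Fbar at 0, and G is its
   composition with B. *)

Require Import Defs.
From Stdlib Require Import Reals Lra FunctionalExtensionality ClassicalEpsilon.
From Coquelicot Require Import Coquelicot.

Open Scope R_scope.

(** * Group and inner-product identities, Cauchy-Schwarz *)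

Lemma plus_minus_cancel {G : AbelianGroup} (x y : G) : plus y (minus x y) = x.
Proof.
unfold minus.
rewrite (plus_comm x), plus_assoc, (plus_opp_r y). apply plus_zero_l.
Qed.

Lemma minus_zero_eq {G : AbelianGroup} (x y : G) : minus x y = zero -> x = y.
Proof.
intros E. rewrite <- (plus_minus_cancel x y), E. apply plus_zero_r.
Qed.

Section InnerProduct.


Context {V : HilbertSpace}.
Implicit Types x y z : V.

Lemma inner_plus_r x y z : inner x (plus y z) = inner x y + inner x z.
Proof. rewrite inner_sym, inner_plus_l, (inner_sym y), (inner_sym z); reflexivity. Qed.

Lemma inner_scal_r (a : R) x y : inner x (scal a y) = a * inner x y.
Proof. rewrite inner_sym, inner_scal_l, inner_sym; reflexivity. Qed.

Lemma inner_opp_l x y : inner (opp x) y = - inner x y.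
Proof. rewrite <- (scal_opp_one (V := V)), inner_scal_l. change (opp one) with (-1). ring. Qed.

Lemma inner_opp_r x y : inner x (opp y) = - inner x y.
Proof. rewrite inner_sym, inner_opp_l, inner_sym; reflexivity. Qed.

Lemma inner_minus_l x y z : inner (minus x y) z = inner x z - inner y z.
Proof. unfold minus. rewrite inner_plus_l, inner_opp_l. ring. Qed.

Lemma inner_minus_r x y z : inner x (minus y z) = inner x y - inner x z.
Proof. unfold minus. rewrite inner_plus_r, inner_opp_r. ring. Qed.

Lemma inner_zero_l x : inner zero x = 0.
Proof.
transitivity (inner (scal 0 x) x).
- f_equal. symmetry. exact (scal_zero_l x).
- rewrite inner_scal_l. ring.
Qed.

Lemma inner_pos x : 0 <= inner x x.
Proof. rewrite inner_norm. apply pow2_ge_0. Qed.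

(** Testing against [minus x y] makes its norm vanish. Later vector identities are reduced in this
    way to ring identities between reals. *)
Lemma inner_ext x y : (forall v, inner x v = inner y v) -> x = y.
Proof.
intros H.
assert (E : inner (minus x y) (minus x y) = 0) by (rewrite inner_minus_l, H; ring).
rewrite inner_norm in E.
assert (E0 : norm (minus x y) = 0) by nra.
apply (norm_eq_zero (V := V)) in E0.
exact (minus_zero_eq x y E0).
Qed.

(** The square of the norm of [<y,y> x - <x,y> y] equals [|y|^2 (|x|^2 |y|^2 - <x,y>^2)]; cancelling
    [|y|^2] requires the case [y = 0] to be treated apart. *)
Lemma cauchy_schwarz x y : Rabs (inner x y) <= norm x * norm y.
Proof.
assert (H := inner_pos (minus (scal (inner y y) x) (scal (inner x y) y))).
rewrite !inner_minus_l, !inner_minus_r, !inner_scal_l, !inner_scal_r in H.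
rewrite (inner_sym y x), !inner_norm in H.
pose proof (norm_ge_0 x); pose proof (norm_ge_0 y).
destruct (Req_dec (norm y) 0) as [Hy|Hy].
- apply norm_eq_zero in Hy. subst y.
  rewrite inner_sym, inner_zero_l, norm_zero, Rabs_R0. lra.
- apply Rsqr_incr_0_var; [|nra].
  rewrite <- Rsqr_abs. unfold Rsqr.
  apply (Rmult_le_reg_l (norm y ^ 2)); nra.
Qed.

Lemma is_linear_inner_r x : is_linear (fun y => inner x y : R_NormedModule).
Proof.
split.
- intros; apply inner_plus_r.
- intros; apply inner_scal_r.
(* The [+ 1] keeps the constant strictly positive when [x = 0], as [is_linear] demands. *)
- exists (norm x + 1). pose proof (norm_ge_0 x).
  split; [lra|intros y].
  apply (Rle_trans _ _ _ (cauchy_schwarz x y)). pose proof (norm_ge_0 y). nra.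
Qed.

End InnerProduct.

(** * Riesz representation for coercive symmetric operators *)

(* Minimizes the energy <A v, v> / 2 - f v: coercivity makes the near-minimizers
   a Cauchy filter, and its limit satisfies the Euler equation.  [A = id] gives
   the Riesz representation theorem, a general [A] gives its invertibility. *)
Lemma coercive_symmetric_riesz {V : HilbertSpace} (A : V -> V) (f : V -> R_NormedModule) :
  is_linear A -> self_adjoint A -> coercive A -> is_linear f ->
  exists w, forall v, inner (A w) v = f v.
Proof.
intros HA HS [g [Hg HC]] Hf.
pose proof (linear_plus _ Hf) as fp. pose proof (linear_scal _ Hf) as fs.
destruct (linear_norm _ Hf) as [M [HM fn]].
change (forall x y : V, f (plus x y) = f x + f y) in fp.
change (forall (k : R) (x : V), f (scal k x) = k * f x) in fs.
change (forall x, Rabs (f x) <= M * norm x) in fn.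
set (J := fun v => inner (A v) v / 2 - f v).
(* Exact second-order Taylor expansion of the quadratic [J] along a line; it serves both the Cauchy
   estimate and the Euler equation. *)
assert (JE : forall (v : V) (t : R) (h : V), J (plus v (scal t h)) =
  J v + t * (inner (A v) h - f h) + t ^ 2 / 2 * inner (A h) h).
{ intros v t h. unfold J.
  rewrite (linear_plus _ HA), (linear_scal _ HA), fp, fs.
  rewrite !inner_plus_l, !inner_plus_r, !inner_scal_l, !inner_scal_r.
  rewrite (HS h v), (inner_sym h). field. }
(* Completing the square in [norm v] after the bounds from coercivity and from [fn]. *)
assert (Jlow : forall v, - (M ^ 2 / (2 * g)) <= J v).
{ intros v. unfold J. specialize (HC v).
  pose proof (fn v) as Fv. apply Rabs_le_between in Fv.
  assert (0 <= (g * norm v - M) ^ 2 / (2 * g)).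
  { apply Rmult_le_pos; [apply pow2_ge_0|]. left. apply Rinv_0_lt_compat. lra. }
  replace ((g * norm v - M) ^ 2 / (2 * g)) with
    (g * norm v ^ 2 / 2 - M * norm v + M ^ 2 / (2 * g)) in H by (field; lra).
  lra. }
(* [completeness] yields suprema, so it is applied to [- J]: the infimum of [J] is [- s]. *)
destruct (completeness (fun r => exists v, r = - J v)) as [s [Hub Hlub]].
{ exists (M ^ 2 / (2 * g)). intros r [v ->]. specialize (Jlow v). lra. }
{ exists (- J zero), zero. reflexivity. }
assert (Jmin : forall v, - s <= J v).
{ intros v. assert (- J v <= s) by (apply Hub; exists v; reflexivity). lra. }
assert (Jinf : forall e, 0 < e -> exists v, J v < - s + e).
{ intros e He. apply NNPP. intros N.
  assert (s <= s - e); [|lra].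
  apply Hlub. intros r [v ->]. apply Rnot_lt_le. intros L.
  apply N. exists v. lra. }
(* The filter generated by the strict sublevel sets of [J] above its infimum. *)
set (F := fun P : V -> Prop => exists e, 0 < e /\ forall v, J v < - s + e -> P v).
assert (PF : ProperFilter F).
{ split.
  - intros P [e [He HP]]. destruct (Jinf e He) as [v Hv]. exists v; auto.
  - split.
    + exists 1; split; [lra|auto].
    + intros P P' [e [He HP]] [e' [He' HP']]. exists (Rmin e e').
      split; [apply Rmin_pos; assumption|].
      intros v Hv. pose proof (Rmin_l e e'). pose proof (Rmin_r e e').
      split; [apply HP|apply HP']; lra.
    + intros P P' HI [e [He HP]]. exists e; auto. }
(* Strong convexity: with [d = v1 - v2], the mean of the two values of [J] exceeds its value at the
   midpoint by [<A d, d> / 8], while the midpoint value is at least [- s]. *)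
assert (Jdist : forall (e : R) (v1 v2 : V), J v1 < - s + e -> J v2 < - s + e ->
  g * norm (minus v1 v2) ^ 2 < 8 * e).
{ intros e v1 v2 H1 H2.
  assert (H3 := Jmin (plus v2 (scal (/ 2) (minus v1 v2)))).
  assert (E : plus v2 (scal 1 (minus v1 v2)) = v1)
    by (rewrite (scal_one (minus v1 v2) : scal 1 _ = _); apply (plus_minus_cancel (G := V))).
  rewrite <- E in H1.
  rewrite JE in H1, H3. specialize (HC (minus v1 v2)). lra. }
assert (CF : cauchy F).
{ intros eps.
  set (e := g * eps ^ 2 / 8).
  assert (He : 0 < e).
  { unfold e. pose proof (cond_pos eps). assert (0 < eps ^ 2) by (apply pow_lt; lra).
    assert (0 < g * eps ^ 2) by (apply Rmult_lt_0_compat; lra). lra. }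
  destruct (Jinf e He) as [v0 Hv0].
  exists v0, e. split; [exact He|]. intros v Hv.
  specialize (Jdist e v v0 Hv Hv0). unfold e in Jdist.
  pose proof (cond_pos eps).
  assert (D : norm (minus v v0) < eps).
  { apply Rnot_le_lt. intros L.
    assert (L2 : eps ^ 2 <= norm (minus v v0) ^ 2) by (apply pow_incr; lra).
    apply (Rmult_le_compat_l g) in L2; lra. }
  exact (norm_compat1 v0 v eps D). }
pose proof (complete_cauchy F PF CF) as HL.
set (w := lim F) in *.
exists w. intros h.
destruct (linear_norm _ HA) as [N [HN An]].
set (q := inner (A h) h). set (K := N * norm h).
assert (Kp : 0 <= K) by (apply Rmult_le_pos; [lra|apply norm_ge_0]).
(* The Euler equation is shown up to any [eps]: a near-minimizer [v] close to [w] gives one half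
   from the continuity of [A] and the other from its own small residual. *)
apply cond_eq. intros eps Heps.
(* Balls control the norm only up to the factor [k]; [d] is chosen so that
   [(K + 1) * (k * d) = eps / 2], the [+ 1] covering [K = 0]. *)
set (k := @norm_factor R_AbsRing V).
assert (Hk : 0 < k) by apply norm_factor_gt_0.
set (d := eps / (2 * (K + 1) * k)).
assert (Hd : 0 < d).
{ apply Rdiv_lt_0_compat; [exact Heps|]. apply Rmult_lt_0_compat; [lra|exact Hk]. }
set (e := eps ^ 2 / (8 * (q + 1))).
assert (Hq : 0 <= q).
{ unfold q. specialize (HC h). pose proof (pow2_ge_0 (norm h)). nra. }
assert (He : 0 < e).
{ apply Rdiv_lt_0_compat; [apply pow_lt; exact Heps|lra]. }
destruct (filter_ex _ (filter_and _ _ (HL (mkposreal d Hd))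
  (ex_intro _ e (conj He (fun v (Hv : J v < - s + e) => Hv)) : F (fun v => J v < - s + e))))
  as [v [Hball Hv]].
apply (norm_compat2 (V := V)) in Hball. simpl in Hball.
assert (D1 : Rabs (inner (A w) h - inner (A v) h) < eps / 2).
{ rewrite <- Rabs_Ropp, Ropp_minus_distr, <- inner_minus_l, <- (linear_minus _ _ _ HA).
  apply (Rle_lt_trans _ _ _ (cauchy_schwarz _ _)).
  apply Rle_lt_trans with (K * norm (minus v w)).
  { apply Rle_trans with (N * norm (minus v w) * norm h).
    - apply Rmult_le_compat_r; [apply norm_ge_0|apply An].
    - right. unfold K. ring. }
  replace (eps / 2) with ((K + 1) * (k * d)) by (unfold d; field; split; lra).
  apply Rle_lt_trans with ((K + 1) * norm (minus v w)).
  - apply Rmult_le_compat_r; [apply norm_ge_0|lra].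
  - apply Rmult_lt_compat_l; [lra|exact Hball]. }
assert (D2 : Rabs (inner (A v) h - f h) < eps / 2).
{ set (r := inner (A v) h - f h).
  (* The best step along [h] would be [- r / q], but [q] may be zero. With [q + 1] instead, [J]
     still drops by at least [r^2 / (2 (q + 1))], which must stay below [e]; the choice of [e] turns
     this into [r^2 < eps^2 / 4]. *)
  assert (H1 := Jmin (plus v (scal (- (r / (q + 1))) h))).
  rewrite JE in H1. fold r q in H1.
  assert (H2 : r ^ 2 / (2 * (q + 1)) < e).
  { apply Rle_lt_trans with (r ^ 2 / (q + 1) - (r / (q + 1)) ^ 2 / 2 * q).
    - apply Rminus_le_0.
      replace (_ - _) with (r ^ 2 / (2 * (q + 1) ^ 2)) by (field; lra).
      apply Rmult_le_pos; [apply pow2_ge_0|].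
      left; apply Rinv_0_lt_compat. assert (0 < (q + 1) ^ 2) by (apply pow_lt; lra). lra.
    - replace (- (r / (q + 1)) * r) with (- (r ^ 2 / (q + 1))) in H1 by (field; lra).
      replace ((- (r / (q + 1))) ^ 2) with ((r / (q + 1)) ^ 2) in H1 by ring. lra. }
  unfold e in H2.
  apply (Rmult_lt_compat_r (2 * (q + 1))) in H2; [|lra].
  replace (r ^ 2 / (2 * (q + 1)) * (2 * (q + 1))) with (r ^ 2) in H2 by (field; lra).
  replace (eps ^ 2 / (8 * (q + 1)) * (2 * (q + 1))) with (eps ^ 2 / 4) in H2 by (field; lra).
  apply Rabs_def1; nra. }
replace (inner (A w) h - f h) with
  ((inner (A w) h - inner (A v) h) + (inner (A v) h - f h)) by ring.
apply (Rle_lt_trans _ _ _ (Rabs_triang _ _)). lra.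
Qed.

(** * Adjoints and inverses of bounded operators *)

(* [is_linear] with its hypotheses typed in the Hilbert space itself, so that the
   lemmas on [inner] rewrite. *)
Lemma is_linear_intro {V W : HilbertSpace} (L : V -> W) (M : R) :
  (forall x y : V, L (plus x y) = plus (L x) (L y)) ->
  (forall (k : R) (x : V), L (scal k x) = scal k (L x)) ->
  0 < M -> (forall x : V, norm (L x) <= M * norm x) ->
  is_linear L.
Proof. intros HP HS HM HN. split; [exact HP|exact HS|exists M; auto]. Qed.

(** For each [w] the functional [v |-> <w, L v>] has a Riesz representative; choice collects these
    into a function, so [epsilon] selects a genuine adjoint. *)
Lemma adjoint_spec {V W : HilbertSpace} (L : V -> W) : is_linear L ->
  forall v w, inner (L v) w = inner v (adjoint L w).
Proof.
intros HL. unfold adjoint. apply epsilon_spec.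
assert (Hex : forall w : W, exists z : V, forall v : V, inner (L v) w = inner v z);
  [intros w|destruct (choice _ Hex) as [S HS]; exists S; auto].
destruct (coercive_symmetric_riesz (fun z : V => z)
  (fun v => inner w (L v) : R_NormedModule)) as [z Hz].
- apply is_linear_id.
- intros x y; reflexivity.
- exists 1. split; [lra|]. intros v. rewrite inner_norm. lra.
- exact (is_linear_comp L _ HL (is_linear_inner_r w)).
- exists z. intros v. rewrite inner_sym, <- Hz. apply inner_sym.
Qed.

Lemma adjoint_eq {V W : HilbertSpace} (L : V -> W) (w : W) (z : V) : is_linear L ->
  (forall v, inner (L v) w = inner v z) -> adjoint L w = z.
Proof.
intros HL Hz. apply inner_ext. intros v.
rewrite inner_sym, <- (adjoint_spec L HL), Hz. apply inner_sym.
Qed.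

Lemma is_linear_adjoint {V W : HilbertSpace} (L : V -> W) :
  is_linear L -> is_linear (adjoint L).
Proof.
intros HL. pose proof (adjoint_spec L HL) as HA.
destruct (linear_norm _ HL) as [M [HM HN]].
apply (is_linear_intro _ M).
- intros x y. apply adjoint_eq; [exact HL|]. intros v.
  rewrite !inner_plus_r, <- !HA. reflexivity.
- intros k x. apply adjoint_eq; [exact HL|]. intros v.
  rewrite !inner_scal_r, <- HA. reflexivity.
- exact HM.
- intros w.
  set (z := adjoint L w).
  (* [|L* w|^2 = <L (L* w), w>], so the bound [M] of [L] passes to the adjoint after division by
     [|L* w|]. *)
  assert (E : norm z ^ 2 <= M * norm z * norm w).
  { rewrite <- inner_norm. unfold z at 2. rewrite <- HA.
    apply (Rle_trans _ _ _ (Rle_abs _)).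
    apply (Rle_trans _ _ _ (cauchy_schwarz _ _)).
    apply Rmult_le_compat_r; [apply norm_ge_0|apply HN]. }
  pose proof (norm_ge_0 z). pose proof (norm_ge_0 w).
  destruct (Req_dec (norm z) 0) as [Hz|Hz]; [nra|].
  apply (Rmult_le_reg_l (norm z)); lra.
Qed.

Lemma adjoint_self_adjoint {V : HilbertSpace} (L : V -> V) :
  is_linear L -> self_adjoint L -> adjoint L = L.
Proof.
intros HL HS. apply functional_extensionality. intros w.
apply adjoint_eq; [exact HL|]. intros v. apply HS.
Qed.

(** From [g |v|^2 <= <L v, v> <= |L v| |v|]. This gives both the injectivity of [L] and the
    boundedness of its inverse. *)
Lemma coercive_inverse_bound {V : HilbertSpace} (L : V -> V) : coercive L ->
  exists C, 0 < C /\ forall v, norm v <= C * norm (L v).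
Proof.
intros [g [Hg HC]]. exists (/ g). split; [apply Rinv_0_lt_compat; exact Hg|].
intros v. specialize (HC v).
pose proof (cauchy_schwarz (L v) v) as CS.
pose proof (Rle_abs (inner (L v) v)).
pose proof (norm_ge_0 v). pose proof (norm_ge_0 (L v)).
apply (Rmult_le_reg_l g); [exact Hg|].
rewrite <- Rmult_assoc, Rinv_r, Rmult_1_l by lra.
destruct (Req_dec (norm v) 0) as [Hv|Hv]; [rewrite Hv; lra|].
apply (Rmult_le_reg_l (norm v)); lra.
Qed.

(** Surjectivity is [coercive_symmetric_riesz] applied to the functionals [<w, .>]; injectivity and
    the norm bound of the inverse come from [coercive_inverse_bound], and linearity of the inverse
    from injectivity. *)
Lemma op_inverse_spec {V : HilbertSpace} (L : V -> V) :
  is_linear L -> self_adjoint L -> coercive L ->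
  is_linear (op_inverse L) /\
  (forall v, op_inverse L (L v) = v) /\ (forall w, L (op_inverse L w) = w).
Proof.
intros HL HS HC. unfold op_inverse. apply epsilon_spec.
assert (Hex : forall w : V, exists v : V, L v = w).
{ intros w. destruct (coercive_symmetric_riesz L _ HL HS HC (is_linear_inner_r w))
    as [v Hv].
  exists v. apply inner_ext. exact Hv. }
destruct (choice _ Hex) as [S HLS]. exists S.
destruct (coercive_inverse_bound L HC) as [C [HC0 HCb]].
assert (Hinj : forall x y : V, L x = L y -> x = y).
{ intros x y E. apply (minus_zero_eq (G := V)), (norm_eq_zero (V := V)).
  assert (E0 : norm (L (minus x y)) = 0).
  { rewrite (linear_minus _ _ _ HL), E.
    transitivity (norm (zero : V)); [f_equal; apply (minus_eq_zero (G := V))|].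
    apply (norm_zero (V := V)). }
  apply Rle_antisym; [|apply norm_ge_0].
  apply (Rle_trans _ _ _ (HCb _)). rewrite E0. lra. }
split; [apply (is_linear_intro _ C)|split].
- intros x y. apply Hinj. rewrite (linear_plus _ HL), !HLS. reflexivity.
- intros k x. apply Hinj. rewrite (linear_scal _ HL), !HLS. reflexivity.
- exact HC0.
- intros w. rewrite <- (HLS w) at 2. apply HCb.
- intros v. apply Hinj, HLS.
- exact HLS.
Qed.

(** * Rank-one perturbations of a coercive operator *)

(** With [L = R] and [b = B* Fbar y] this is the Hessian of the SAC objective, and it agrees with
    [sac_gram] because [R* = R]. *)
Definition rank_one_update {V : HilbertSpace} (L : V -> V) (b u : V) : V :=
  plus (scal (inner b u) b) (L u).

Section RankOneUpdate.

Context {V : HilbertSpace} (L : V -> V).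
Hypotheses (L_linear : is_linear L) (L_self_adjoint : self_adjoint L)
  (L_coercive : coercive L).

Lemma inner_rank_one_update b u v :
  inner (rank_one_update L b u) v = inner b u * inner b v + inner (L u) v.
Proof. unfold rank_one_update. rewrite inner_plus_l, inner_scal_l. reflexivity. Qed.

Lemma is_linear_rank_one_update b : is_linear (rank_one_update L b).
Proof.
destruct (linear_norm _ L_linear) as [M [HM HN]].
apply (is_linear_intro _ (norm b ^ 2 + M)).
- intros x y. apply inner_ext. intros v.
  rewrite inner_plus_l, !inner_rank_one_update, (linear_plus _ L_linear).
  rewrite inner_plus_l, inner_plus_r. ring.
- intros k x. apply inner_ext. intros v.
  rewrite inner_scal_l, !inner_rank_one_update, (linear_scal _ L_linear).
  rewrite inner_scal_l, inner_scal_r. ring.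
- pose proof (pow2_ge_0 (norm b)). lra.
- intros u. unfold rank_one_update.
  apply (Rle_trans _ _ _ (norm_triangle (V := V) _ _)).
  rewrite Rmult_plus_distr_r. apply Rplus_le_compat; [|apply HN].
  apply (Rle_trans _ _ _ (norm_scal (V := V) _ _)).
  apply Rle_trans with (norm b * norm u * norm b); [|right; ring].
  apply Rmult_le_compat_r; [apply norm_ge_0|apply cauchy_schwarz].
Qed.

Lemma self_adjoint_rank_one_update b : self_adjoint (rank_one_update L b).
Proof.
intros x y.
rewrite (inner_sym x), !inner_rank_one_update, L_self_adjoint, (inner_sym x). ring.
Qed.

Lemma coercive_rank_one_update b : coercive (rank_one_update L b).
Proof.
destruct L_coercive as [g [Hg HC]]. exists g. split; [exact Hg|].
intros v. rewrite inner_rank_one_update. specialize (HC v). nra.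
Qed.

(** Writing [b = L (L^-1 b)] reduces this to coercivity. It keeps the Sherman-Morrison denominator
    at least 1. *)
Lemma inner_op_inverse_pos b : 0 <= inner b (op_inverse L b).
Proof.
destruct (op_inverse_spec L L_linear L_self_adjoint L_coercive) as [_ [_ E]].
rewrite <- (E b) at 1. destruct L_coercive as [g [Hg HC]].
specialize (HC (op_inverse L b)). pose proof (pow2_ge_0 (norm (op_inverse L b))).
nra.
Qed.

(* Sherman-Morrison *)
Lemma op_inverse_rank_one_update b (a : R) :
  op_inverse (rank_one_update L b) (scal a b) =
  scal (a / (1 + inner b (op_inverse L b))) (op_inverse L b).
Proof.
destruct (op_inverse_spec L L_linear L_self_adjoint L_coercive) as [_ [_ E]].
destruct (op_inverse_spec _ (is_linear_rank_one_update b)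
  (self_adjoint_rank_one_update b) (coercive_rank_one_update b)) as [_ [K _]].
(* Since [K] inverts the update from the left, it suffices that the proposed vector solves the
   equation with right-hand side [scal a b]. *)
rewrite <- K. f_equal. apply inner_ext. intros v.
rewrite inner_rank_one_update, (linear_scal _ L_linear), E.
rewrite inner_scal_r, !inner_scal_l.
pose proof (inner_op_inverse_pos b). field. lra.
Qed.

End RankOneUpdate.

(** * Differentiability of quadratic forms and of their quotients *)

(** By bilinearity the remainder is exactly [<f d, g d>] with [d = y - x], hence at most
    [M N |d|^2]. *)
Lemma filterdiff_inner {V W : HilbertSpace} (f g : V -> W) (x : V) :
  is_linear f -> is_linear g ->
  filterdiff (fun y => inner (f y) (g y) : R_NormedModule) (locally x)
    (fun h => inner (f x) (g h) + inner (f h) (g x)).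
Proof.
intros Hf Hg.
destruct (linear_norm _ Hf) as [M [HM fM]].
destruct (linear_norm _ Hg) as [N [HN gN]].
split.
- apply (is_linear_ext (fun h : V => plus (inner (f x) (g h) : R_NormedModule)
    (inner (g x) (f h)))).
  { intros h. rewrite (inner_sym (g x)). reflexivity. }
  apply (is_linear_comp (fun h : V => (inner (f x) (g h), inner (g x) (f h)))
    (fun p => plus (fst p) (snd p))); [|apply is_linear_plus].
  apply is_linear_prod.
  + exact (is_linear_comp g _ Hg (is_linear_inner_r (f x))).
  + exact (is_linear_comp f _ Hf (is_linear_inner_r (g x))).
- intros z Hz eps. pose proof (is_filter_lim_locally_unique (V := V) x z Hz). subst z.
  apply (locally_le_locally_norm (V := V)).
  assert (Hd : 0 < eps / (M * N)).
  { apply Rdiv_lt_0_compat; [apply cond_pos|apply Rmult_lt_0_compat; assumption]. }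
  exists (mkposreal _ Hd). intros y Hy.
  unfold ball_norm in Hy. simpl in Hy.
  set (d := minus y x) in *.
  assert (E : minus (minus (inner (f y) (g y) : R_NormedModule) (inner (f x) (g x)))
    (inner (f x) (g d) + inner (f d) (g x)) = inner (f d) (g d)).
  { assert (Ef : f d = minus (f y) (f x)) by exact (linear_minus f y x Hf).
    assert (Eg : g d = minus (g y) (g x)) by exact (linear_minus g y x Hg).
    rewrite Ef, Eg,  !inner_minus_l, !inner_minus_r. unfold minus, plus, opp; simpl. ring. }
  rewrite E.
  apply Rle_trans with (norm (f d) * norm (g d)); [apply cauchy_schwarz|].
  pose proof (norm_ge_0 d).
  apply Rle_trans with ((M * norm d) * (N * norm d)).
  { apply Rmult_le_compat; try apply norm_ge_0; [apply fM|apply gN]. }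
  replace ((M * norm d) * (N * norm d)) with ((M * N * norm d) * norm d) by ring.
  apply Rmult_le_compat_r; [assumption|].
  replace (pos eps) with (M * N * (eps / (M * N))) by (field; lra).
  apply Rmult_le_compat_l; [nra|]. left. exact Hy.
Qed.

(** Product rule for the Sherman-Morrison form of the action. The derivative [dk] of the scalar
    factor can stay unspecified: at the origin it multiplies [c zero = zero]. *)
Lemma filterdiff_damped {V W : HilbertSpace} (b c : V -> W) (a : R) (x : V) :
  is_linear b -> is_linear c -> 0 <= inner (b x) (c x) ->
  exists dk : V -> R,
    filterdiff (fun y => scal (a / (1 + inner (b y) (c y))) (c y)) (locally x)
      (fun h => plus (scal (dk h) (c x))
                     (scal (a / (1 + inner (b x) (c x))) (c h))).
Proof.
intros Hb Hc Hpos. eexists.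
apply (filterdiff_scal_fct (K := R_AbsRing) x
  (fun y => a / (1 + inner (b y) (c y))) c).
- exact Rmult_comm.
- apply (filterdiff_comp' (fun y => inner (b y) (c y) : R_NormedModule)
    (fun z : R_NormedModule => a / (1 + z) : R_NormedModule)).
  + apply filterdiff_inner; assumption.
  + assert (D : is_derive (fun z : R => a / (1 + z)) (inner (b x) (c x))
      (- a / (1 + inner (b x) (c x)) ^ 2)).
    { auto_derive; [lra|field; lra]. }
    exact D.
- apply filterdiff_linear, Hc.
Qed.

(** * The SAC action: closed form, optimality, derivative *)

Section SACAction.

Context {H U : HilbertSpace} (B : U -> H) (Rop : U -> U) (Fbar : H -> H) (alpha_d : R).
Hypotheses (B_linear : is_linear B) (R_linear : is_linear Rop)
  (R_self_adjoint : self_adjoint Rop) (R_coercive : coercive Rop).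

Lemma adjoint_sac_P (y : H) (r : R) :
  adjoint (sac_P B Fbar y) r = scal r (adjoint B (Fbar y)).
Proof.
apply (adjoint_eq (W := R_Hilbert)).
- exact (is_linear_comp B _ B_linear (is_linear_inner_r (Fbar y))).
- intros u. rewrite inner_scal_r, <- (adjoint_spec B B_linear), (inner_sym (B u)).
  apply Rmult_comm.
Qed.

(** [P] is the functional [<b, .>] with [b = B* Fbar y], so [P* P] is the rank-one map
    [u |-> <b,u> b]. *)
Lemma sac_action_rank_one (y : H) :
  sac_action B Rop Fbar alpha_d y =
  op_inverse (rank_one_update Rop (adjoint B (Fbar y)))
    (scal alpha_d (adjoint B (Fbar y))).
Proof.
unfold sac_action. rewrite adjoint_sac_P. f_equal. f_equal.
apply functional_extensionality. intros u.
rewrite adjoint_sac_P, (adjoint_self_adjoint _ R_linear R_self_adjoint).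
unfold rank_one_update, sac_P.
rewrite (inner_sym (Fbar y)), (adjoint_spec B B_linear), inner_sym. reflexivity.
Qed.

Lemma sac_action_eq (y : H) :
  let b := adjoint B (Fbar y) in
  let c := op_inverse Rop b in
  sac_action B Rop Fbar alpha_d y = scal (alpha_d / (1 + inner b c)) c.
Proof.
intros b c. rewrite sac_action_rank_one. apply op_inverse_rank_one_update; assumption.
Qed.

Lemma sac_G_eq (y : H) :
  sac_G B Rop Fbar alpha_d y = B (sac_action B Rop Fbar alpha_d y).
Proof.
rewrite sac_action_rank_one. unfold sac_G, sac_gram.
rewrite (adjoint_self_adjoint _ R_linear R_self_adjoint). reflexivity.
Qed.

(** The hypothesis is the Euler equation at [u]; tested against [d] it cancels the terms linear in
    [d], leaving half the Hessian form. *)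
Lemma sac_objective_shift (y : H) (u d : U) :
  rank_one_update Rop (adjoint B (Fbar y)) u = scal alpha_d (adjoint B (Fbar y)) ->
  sac_objective B Rop Fbar alpha_d y (plus u d) =
  sac_objective B Rop Fbar alpha_d y u
  + (inner (adjoint B (Fbar y)) d ^ 2 + inner (Rop d) d) / 2.
Proof.
intros E.
assert (E1 : inner (adjoint B (Fbar y)) u * inner (adjoint B (Fbar y)) d
  + inner (Rop u) d = alpha_d * inner (adjoint B (Fbar y)) d).
{ rewrite <- inner_rank_one_update, E. apply inner_scal_l. }
assert (EB : forall w : U, inner (Fbar y) (B w) = inner (adjoint B (Fbar y)) w).
{ intros w. rewrite inner_sym, (adjoint_spec B B_linear). apply inner_sym. }
unfold sac_objective. rewrite !EB.
assert (ER : Rop (plus u d) = plus (Rop u) (Rop d)) by exact (linear_plus _ R_linear u d).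
rewrite ER, !inner_plus_l, !inner_plus_r.
rewrite <- (R_self_adjoint u d), (inner_sym d (Rop d)), (inner_sym d (Rop u)).
rewrite (inner_sym u (Rop u)). nra.
Qed.

Lemma sac_minimizer_iff (y : H) (u : U) :
  sac_minimizer B Rop Fbar alpha_d y u <-> u = sac_action B Rop Fbar alpha_d y.
Proof.
set (us := sac_action B Rop Fbar alpha_d y).
assert (E : rank_one_update Rop (adjoint B (Fbar y)) us =
  scal alpha_d (adjoint B (Fbar y))).
{ unfold us. rewrite sac_action_rank_one.
  apply op_inverse_spec; [apply is_linear_rank_one_update|
    apply self_adjoint_rank_one_update|apply coercive_rank_one_update]; assumption. }
destruct R_coercive as [g [Hg HC]].
(* Quadratic growth away from [us], by coercivity of [R]: it yields minimality and uniqueness at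
   once. *)
assert (J : forall v : U, sac_objective B Rop Fbar alpha_d y us
  + g * norm (minus v us) ^ 2 / 2 <= sac_objective B Rop Fbar alpha_d y v).
{ intros v.
  assert (Ev : plus us (minus v us) = v) by apply (plus_minus_cancel (G := U)).
  pose proof (sac_objective_shift y us (minus v us) E) as S.
  rewrite Ev in S. rewrite S.
  specialize (HC (minus v us)).
  pose proof (pow2_ge_0 (inner (adjoint B (Fbar y)) (minus v us))). lra. }
split.
- intros Hu. specialize (Hu us). specialize (J u).
  pose proof (norm_ge_0 (minus u us)) as N.
  apply (minus_zero_eq (G := U)), (norm_eq_zero (V := U)).
  assert (N2 : g * norm (minus u us) ^ 2 <= 0) by lra.
  destruct (Req_dec (norm (minus u us)) 0) as [Z|Z]; [exact Z|exfalso].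
  assert (0 < norm (minus u us) ^ 2) by (apply pow_lt; lra). nra.
- intros -> v. specialize (J v). pose proof (pow2_ge_0 (norm (minus v us))). nra.
Qed.

Hypothesis F_linear : is_linear Fbar.

Lemma is_linear_feedback : is_linear (fun y => op_inverse Rop (adjoint B (Fbar y))).
Proof.
apply (is_linear_comp Fbar (fun z => op_inverse Rop (adjoint B z)) F_linear).
apply (is_linear_comp (adjoint B) (op_inverse Rop)).
- apply is_linear_adjoint, B_linear.
- apply op_inverse_spec; assumption.
Qed.

Lemma filterdiff_sac_action (x : H) :
  let c := fun y => op_inverse Rop (adjoint B (Fbar y)) in
  exists dk : H -> R,
    filterdiff (sac_action B Rop Fbar alpha_d) (locally x)
      (fun h => plus (scal (dk h) (c x))
         (scal (alpha_d / (1 + inner (adjoint B (Fbar x)) (c x))) (c h))).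
Proof.
intros c.
destruct (filterdiff_damped (fun y => adjoint B (Fbar y)) c alpha_d x) as [dk D].
- exact (is_linear_comp _ _ F_linear (is_linear_adjoint B B_linear)).
- apply is_linear_feedback.
- apply inner_op_inverse_pos; assumption.
- exists dk. eapply filterdiff_ext; [|exact D].
  intros y. symmetry. apply sac_action_eq.
Qed.

(** At the origin [c] vanishes, which kills the [dk] term and reduces the scalar factor to
    [alpha_d / (1 + 0)]. *)
Lemma filterdiff_sac_action_zero :
  filterdiff (sac_action B Rop Fbar alpha_d) (locally (zero : H))
    (fun h => scal alpha_d (op_inverse Rop (adjoint B (Fbar h)))).
Proof.
destruct (filterdiff_sac_action zero) as [dk D].
eapply filterdiff_ext_lin; [exact D|].
intros h. simpl.
assert (Z : op_inverse Rop (adjoint B (Fbar zero)) = zero)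
  by exact (linear_zero _ is_linear_feedback).
rewrite Z. apply inner_ext. intros v.
rewrite inner_plus_l, !inner_scal_l, (inner_sym _ zero), !inner_zero_l. field.
Qed.

Lemma sac_action_zero : sac_action B Rop Fbar alpha_d zero = zero.
Proof.
assert (Z : op_inverse Rop (adjoint B (Fbar zero)) = zero)
  by exact (linear_zero _ is_linear_feedback).
rewrite sac_action_eq, Z. apply (scal_zero_r (V := U)).
Qed.

End SACAction.

(** * The equilibrium and the closed-loop theorem *)

(** The difference quotients of the semigroup at the origin are identically zero for [h > 0], so
    their limit exists and is zero. *)
Lemma generator_zero {V : HilbertSpace} (A : unbounded_operator V) (S : R -> V -> V) :
  generates A S -> op_dom A zero /\ op_fun A zero = zero.
Proof.
intros [HS HG]. apply HG.
apply filterlim_ext_loc with (f := fun _ : R => (zero : V)); [|apply filterlim_const].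
exists (mkposreal 1 Rlt_0_1). intros h _ Hh.
assert (E : S h zero = zero)
  by exact (linear_zero _ (sg_bounded HS (Rlt_le _ _ Hh))).
rewrite E. apply inner_ext. intros v.
rewrite inner_scal_l, inner_minus_l, inner_zero_l. ring.
Qed.

Theorem theorem3p2 (H U : HilbertSpace)
  (H_separable : separable H) (U_separable : separable U)
  (A : unbounded_operator H) (A_dense : dense (op_dom A))
  (S : R -> H -> H) (A_generates : generates A S)
  (B : U -> H) (B_bounded : is_linear B)
  (Q : H -> H) (Q_bounded : is_linear Q)
  (PT : H -> H) (PT_bounded : is_linear PT)
  (PT_self_adjoint : self_adjoint PT) (PT_positive : positive_op PT)
  (Rop : U -> U) (R_bounded : is_linear Rop)
  (R_self_adjoint : self_adjoint Rop) (R_coercive : coercive Rop)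
  (T : R) (T_pos : 0 < T) (alpha_d : R) (alpha_d_neg : alpha_d < 0) (y0 : H)
  (F : R -> H -> H) (F_lyapunov : mild_lyapunov_solution S Q PT T F) :
  let Fbar := F 0 in
  let u_opt := sac_action B Rop Fbar alpha_d in
  let G := sac_G B Rop Fbar alpha_d in
  let Bstar := adjoint B in
  let Rstar_inv := op_inverse (adjoint Rop) in
  (forall (y : H) (u : U),
     sac_minimizer B Rop Fbar alpha_d y u <-> u = u_opt y) /\
  is_domin (locally (zero : H)) (fun y : H => y)
    (fun y : H => minus (u_opt y) (scal alpha_d (Rstar_inv (Bstar (Fbar y))))) /\
  (forall y : H, ex_filterdiff G (locally y)) /\
  is_linearization_at
    {| sl_op := A; sl_nonlin := G; sl_init := y0 |} zero
    {| lin_op :=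
         op_plus A (fun y => scal alpha_d (B (Rstar_inv (Bstar (Fbar y)))));
       lin_init := y0 |}.
Proof.
intros Fbar u_opt G Bstar Rstar_inv.
assert (F_linear : is_linear Fbar) by (apply (lyap_bounded F_lyapunov); lra).
assert (ER : Rstar_inv = op_inverse Rop).
{ unfold Rstar_inv. rewrite (adjoint_self_adjoint _ R_bounded R_self_adjoint). reflexivity. }
assert (EG : forall y, B (u_opt y) = G y) by (intros y; symmetry; apply sac_G_eq; assumption).
assert (D0 : filterdiff u_opt (locally (zero : H))
  (fun h => scal alpha_d (Rstar_inv (Bstar (Fbar h))))).
{ rewrite ER. apply filterdiff_sac_action_zero; assumption. }
assert (U0 : u_opt zero = zero) by (apply sac_action_zero; assumption).
split; [|split; [|split]].
- intros y u. apply sac_minimizer_iff; assumption.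
- intros eps.
  (* As [u_opt zero = zero], the differentiability remainder at the origin is literally the little-o
     claim; the identity function proves that [locally zero] converges to [zero]. *)
  apply filter_imp with (2 := proj2 D0 zero (fun P HP => HP) eps).
  intros y Hy.
  assert (Ey : minus y zero = y) by exact (minus_zero_r (G := H) y).
  assert (Eu : minus (u_opt y) (u_opt zero) = u_opt y)
    by (rewrite U0; exact (minus_zero_r (G := U) (u_opt y))).
  change (norm (minus (minus (u_opt y) (u_opt zero))
    (scal alpha_d (Rstar_inv (Bstar (Fbar (minus y zero))))))
    <= eps * norm (minus y zero)) in Hy.
  rewrite Eu, Ey in Hy. exact Hy.
- intros x. destruct (filterdiff_sac_action B Rop Fbar alpha_d B_bounded R_bounded
    R_self_adjoint R_coercive F_linear x) as [dk D].
  eexists. eapply filterdiff_ext; [exact EG|].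
  (* Chain rule for [G] as [B] after [u_opt]. *)
  apply (filterdiff_comp' u_opt B); [exact D|].
  apply filterdiff_linear, B_bounded.
- destruct (generator_zero A S A_generates) as [A0 A1].
  split.
  + split; [exact A0|]. simpl. rewrite A1, <- EG, U0.
    assert (B0 : B zero = zero) by exact (linear_zero _ B_bounded).
    rewrite B0. apply (plus_zero_l (G := H)).
  + exists (fun h => scal alpha_d (B (Rstar_inv (Bstar (Fbar h))))).
    split; [|split].
    * simpl. eapply filterdiff_ext; [exact EG|].
      eapply filterdiff_ext_lin.
      -- apply (filterdiff_comp' u_opt B); [exact D0|].
         apply filterdiff_linear, B_bounded.
      (* The chain rule leaves [alpha_d] inside [B]; the stated feedback has it outside. *)
      -- intros h. exact (linear_scal _ B_bounded _ _).
    * split; [intros x; reflexivity|intros x _; reflexivity].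
    * symmetry. exact (minus_zero_r (G := H) y0).
Qed.
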